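(* Let $\mathcal{S}$ be a non-degenerate thick-lined polar space of rank at least $2$ (the rank may be an infinite cardinal), and let $a,b$ be two opposite points of $\mathcal{S}$. Consider the following two properties of the pair $\{a,b\}$: (R2) every generator $M$ of $\mathcal{S}$ which contains a generator of the polar space $\{a,b\}^\perp$ satisfies $M\cap\{a,b\}^{\perp\perp}\neq\emptyset$; (R3) for any two generators $X$ and $Y$ of $\{a,b\}^\perp$ (possibly $X=Y$) we have $(X\cup Y)^\perp=\langle (X\cap Y)\cup\{a,b\}^{\perp\perp}\rangle$. Then (R2) holds for $\{a,b\}$ if and only if (R3) holds for $\{a,b\}$.
   Context: A polar space is non-degenerate if no point is collinear with all points, thick-lined if every line has at least three points. Two points $x,y$ are collinear, written $x\perp y$, if they are equal or lie on a common line. For a set $X$ of points, $X^\perp$ is the set of points collinear with every point of $X$, $X^{\perp\perp}=(X^\perp)^\perp$, and $\{a,b\}^\perp=(\{a,b\})^\perp$. A subspace is a set of points containing every line meeting it in at least two points; it is singular if its points are pairwise collinear; $\langle X\rangle$ denotes the subspace of $\mathcal{S}$ generated by a set $X$ of points. Generators are the maximal singular subspaces. Two points are opposite if they are not collinear. For opposite points $a,b$, $\{a,b\}^\perp$ is a subspace which is itself a polar space; its generators are the singular subspaces maximal among the singular subspaces contained in $\{a,b\}^\perp$. *)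

(* Defs.v *)
From mathcomp Require Import all_boot.
From mathcomp Require Import boolp classical_sets.

Set Implicit Arguments.
Unset Strict Implicit.
Unset Printing Implicit Defensive.

Local Open Scope classical_set_scope.

(* Lines are identified with their sets of points. Two distinct lines are not
   required to meet in at most one point: as usual with the Buekenhout-Shult
   axiom, this is a theorem about non-degenerate polar spaces. *)
Record geometry := Geometry {
  point :> Type;
  line : set (set point);
  line_two_points : forall l, line l -> exists x y, [/\ x <> y, l x & l y]
}.

Arguments line {_} _.

Section Geometry.
Variable S : geometry.
Implicit Types (a b p q x y z : S) (A X Y M N l : set S).

Definition collinear x y := x = y \/ exists l, [/\ line l, l x & l y].

Definition opposite x y := ~ collinear x y.

Definition perp X : set S := [set y | forall x, X x -> collinear y x].

Definition perp2 X : set S := perp (perp X).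

Definition subspace X :=
  forall l x y, line l -> x <> y -> l x -> l y -> X x -> X y -> l `<=` X.

Definition singular X :=
  subspace X /\ forall x y, X x -> X y -> collinear x y.

Definition span X : set S := smallest subspace X.

Definition generator M :=
  singular M /\ forall N, singular N -> M `<=` N -> N = M.

Definition generator_in A M :=
  [/\ singular M, M `<=` A
    & forall N, singular N -> N `<=` A -> M `<=` N -> N = M].

(* The Buekenhout-Shult one-or-all axiom. *)
Definition polar_space :=
  forall p l, line l ->
    (exists! q, l q /\ collinear p q) \/ (forall q, l q -> collinear p q).

Definition nondegenerate := ~ exists p, forall q, collinear p q.

Definition thick_lined :=
  forall l, line l ->
    exists x y z, [/\ x <> y, x <> z & y <> z] /\ [/\ l x, l y & l z].

(* The rank is the least upper bound of the lengths of the well-ordered chains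
   of nonempty singular subspaces; a finite n is at most this (possibly
   infinite) cardinal exactly when some such chain has length n. *)
Definition rank_ge (n : nat) :=
  exists X : nat -> set S,
    (forall i, i < n -> singular (X i) /\ X i !=set0) /\
    (forall i, i.+1 < n -> X i `<` X i.+1).

Definition R2 a b :=
  forall M, generator M ->
    (exists N, generator_in (perp [set a; b]) N /\ N `<=` M) ->
    M `&` perp2 [set a; b] !=set0.

Definition R3 a b :=
  forall X Y,
    generator_in (perp [set a; b]) X -> generator_in (perp [set a; b]) Y ->
    perp (X `|` Y) = span ((X `&` Y) `|` perp2 [set a; b]).

End Geometry.

(* Main.v *)
(* Write H = {a,b}^perp and L = H^perp. In a non-degenerate polar space
   p^perp <= q^perp forces p = q; hence any two distinct points c, d of L are
   opposite with {c,d}^perp = H, and the line joining c in L to a point z of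
   c^perp meets H, in a point collinear with everything in H that is collinear
   with z.
   (R2) => (R3): by (R2), a generator through X and a point z of X^perp contains
   a point of L collinear with z, so that z outside H lies on a line joining a
   point of L to H; for z in (X u Y)^perp the trace of this line on H lies in
   both X and Y by maximality.
   (R3) => (R2): for a generator N of H, the union of the cones N^perp n c^perp
   with c in L is a subspace, so (R3) with X = Y = N shows that it is N^perp. A
   generator M containing N has a point outside N; it lies in the cone of some
   c in L, and the line joining it to c meets N, so c is in M. *)
Require Import Defs.
From mathcomp Require Import all_boot.
From mathcomp Require Import boolp classical_sets.

Set Implicit Arguments.
Unset Strict Implicit.
Unset Printing Implicit Defensive.

Local Open Scope classical_set_scope.

(** * Perps and generated subspaces *)

Section Perp.
Variable S : geometry.
Implicit Types (a b c d p q x y z : S) (A K X Y M N l : set S).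

Lemma collinear_refl x : collinear x x.
Proof. by left. Qed.

Lemma collinear_sym x y : collinear x y -> collinear y x.
Proof. by case=> [->|[l [ll lx ly]]]; [left|right; exists l]. Qed.

Lemma opposite_sym a b : opposite a b -> opposite b a.
Proof. by move=> ab /collinear_sym. Qed.

Lemma line_collinear l x y : line l -> l x -> l y -> collinear x y.
Proof. by move=> ll lx ly; right; exists l. Qed.

Lemma perp_pairP a b x :
  perp [set a; b] x <-> collinear x a /\ collinear x b.
Proof.
split=> [abx|[xa xb] y [->|->]//].
by split; apply: abx; [left|right].
Qed.

Lemma perp_anti A X : A `<=` X -> perp X `<=` perp A.
Proof. by move=> AX y Xy x /AX /Xy. Qed.

Lemma sub_perp2 A : A `<=` perp2 A.
Proof. by move=> x Ax y yA; exact/collinear_sym/yA. Qed.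

Lemma perp3 A : perp (perp2 A) = perp A.
Proof.
by apply/seteqP; split; [exact/perp_anti/sub_perp2|exact: sub_perp2].
Qed.

Lemma span_subspace A : subspace (span A).
Proof.
move=> l x y ll xy lx ly Ax Ay z lz X [sX AX].
by apply: (sX l x y ll xy lx ly _ _ z lz); [apply: Ax|apply: Ay].
Qed.

Lemma sub_span A : A `<=` span A.
Proof. by move=> x Ax X [_]; exact. Qed.

Lemma span_sub A X : subspace X -> A `<=` X -> span A `<=` X.
Proof. by move=> sX AX x; apply. Qed.

End Perp.

(** * Singular subspaces and generators of a polar space *)

Section PolarSpace.
Variable S : geometry.
Hypothesis hpolar : polar_space S.
Implicit Types (a b c d p q x y z : S) (A K X Y M N l : set S).

Lemma exists_collinear p l : line l -> exists q, l q /\ collinear p q.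
Proof.
move=> ll; case: (hpolar p ll) => [[q [[lq pq] _]]|all]; first by exists q.
by have [x [_ [_ lx _]]] := line_two_points ll; exists x; split; auto.
Qed.

Lemma collinear_line p l x y z : line l -> x <> y -> l x -> l y -> l z ->
  collinear p x -> collinear p y -> collinear p z.
Proof.
move=> ll xy lx ly lz px py; case: (hpolar p ll) => [[q [_ qu]]|]; last exact.
by case: xy; rewrite -(qu x) ?(qu y).
Qed.

Lemma perp_subspace A : subspace (perp A).
Proof.
move=> l x y ll xy lx ly Ax Ay z lz w Aw; apply: collinear_sym.
by apply: (@collinear_line w l x y z) => //; apply: collinear_sym; auto.
Qed.

Lemma perp2_singular K : (forall x y, K x -> K y -> collinear x y) ->
  singular (perp2 K).
Proof.
move=> cK; split=> [|x y Kx Ky]; first exact: perp_subspace.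
have KK : K `<=` perp K by move=> u Ku v Kv; exact: cK.
by apply: Kx; exact: perp_anti KK _ Ky.
Qed.

Lemma clique_setU1 X x : (forall y z, X y -> X z -> collinear y z) ->
  perp X x -> forall y z, (x |` X) y -> (x |` X) z -> collinear y z.
Proof.
move=> cX xX y z [->|Xy] [->|Xz]; [exact: collinear_refl|exact: xX| |exact: cX].
exact/collinear_sym/xX.
Qed.

Lemma generator_in_perp A N x : generator_in (perp A) N ->
  perp A x -> perp N x -> N x.
Proof.
move=> [[_ cN] NA maxN] Ax Nx.
have sK := perp2_singular (clique_setU1 cN Nx).
rewrite -(maxN _ sK); first by apply: sub_perp2; left.
  by rewrite -(perp3 A); do 2 apply: perp_anti; move=> y [->|/NA].
by move=> y Ny; apply: sub_perp2; right.
Qed.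

Lemma generator_perp M x : generator M -> perp M x -> M x.
Proof.
move=> [[sM cM] maxM]; apply: (@generator_in_perp set0) => //.
by split=> // [y _ z []|N sN _]; exact: maxM.
Qed.

Lemma generator_extend K : (forall x y, K x -> K y -> collinear x y) ->
  exists2 M, generator M & K `<=` M.
Proof.
(* Zorn's lemma also asks for the union of the empty chain; putting [K] inside the property, rather
   than requiring [K] to lie in [A], covers it. A maximal clique is its own perp, hence a
   subspace. *)
move=> cK; pose P A := forall x y, (K `|` A) x -> (K `|` A) y -> collinear x y.
have [|A [PA maxA]] := @Zorn_bigcup S P.
  move=> F FP totF x y [Kx|[X FX Xx]] [Ky|[Y FY Yy]].
  - exact: cK.
  - by apply: (FP _ FY); [left|right].
  - by apply: (FP _ FX); [right|left].
  - have [XY|YX] := totF _ _ FX FY.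
      by apply: (FP _ FY); right=> //; exact: XY.
    by apply: (FP _ FX); right=> //; exact: YX.
have closed x : perp (K `|` A) x -> (K `|` A) x.
  move=> xKA; right; apply: contrapT => nAx.
  apply: (maxA (x |` A)); first by split=> [|sub]; [right|apply/nAx/sub; left].
  by move=> y z; rewrite setUCA; exact: clique_setU1.
have KAE : perp (K `|` A) = K `|` A.
  by apply/seteqP; split=> // x KAx y KAy; exact: PA.
exists (K `|` A) => [|x]; last by left.
split=> [|N [_ cN] KAN]; first by split=> //; rewrite -KAE; exact: perp_subspace.
apply/seteqP; split=> // x Nx.
by apply: closed => y /KAN; exact: cN.
Qed.

(** [h] is a point of the line [ax] collinear with [b], which [a] is not. *)
Lemma project a b x : opposite a b -> collinear x a -> x <> a ->
  exists l h, [/\ line l, l a, l x & [/\ l h, h <> a & perp [set a; b] h]].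
Proof.
move=> ab [//|[l [ll lx la]]] xa.
have [h [lh bh]] := exists_collinear b ll.
exists l, h; split=> //; split=> // [ha|].
  by apply: ab; apply: collinear_sym; rewrite -ha.
by apply/perp_pairP; split; [exact: line_collinear lh la|exact: collinear_sym].
Qed.

End PolarSpace.

(** * The hyperbolic line of two opposite points *)

Section HyperbolicLine.
Variable S : geometry.
Hypotheses (hpolar : polar_space S) (hnondeg : nondegenerate S).
Implicit Types (a b c d p q x y z : S) (A K X Y M N l : set S).

(** Otherwise take [z] not collinear with [q], and [u] on the line [pq] collinear with [z]. Both the
    perp of [p] and that of [z] lie in the perp of [u], which forces [u] to be collinear with every
    point. *)
Lemma collinear_sub_inj p q :
  (forall x, collinear x p -> collinear x q) -> p = q.
Proof.
move=> pq; apply: contrapT => npq.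
have [//|[l [ll lp lq]]] := pq p (collinear_refl p).
have [z nzq] : exists z, ~ collinear z q.
  apply: contrapT => nz; apply: hnondeg; exists q => x.
  by apply: collinear_sym; apply: contrapT => nxq; apply: nz; exists x.
have nzp : ~ collinear z p by move/pq.
have [u [lu zu]] := exists_collinear hpolar z ll.
have pu x : collinear x p -> collinear x u.
  by move=> xp; apply: (collinear_line hpolar ll npq lp lq lu xp); exact: pq.
have z_u : z <> u by move=> zE; apply/nzp; rewrite zE; exact: line_collinear lp.
have zu_sub x : collinear x z -> collinear x u.
  move=> xz; have [->//|nxz] := pselect (x = z).
  have [m [h [lm mz mx [mh hz /perp_pairP[_ hp]]]]] := project hpolar nzp xz nxz.
  apply: collinear_sym.
  apply: (collinear_line hpolar lm hz mh mz mx); apply: collinear_sym => //.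
  exact: pu.
(* A point [x] opposite [u] would be collinear with some [v <> u] on the line
   [zu]; as [p] sees no other point of [xv], it sees [v], hence [z]. *)
apply: hnondeg; exists u => x; apply: collinear_sym; apply: contrapT => nxu.
case: zu => [//|[m [lm mz mu]]].
have [v [mv xv]] := exists_collinear hpolar x lm.
have vu : v <> u by move=> vE; apply: nxu; rewrite -vE.
have vuC : collinear v u by exact: line_collinear mu.
case: (xv) => [xE|[n [ln nx nv]]]; first by apply: nxu; rewrite xE.
have [w [nw pw]] := exists_collinear hpolar p ln.
have wv : w = v.
  apply: contrapT => wv; apply: nxu; apply: collinear_sym.
  apply: (collinear_line hpolar ln wv nw nv nx); apply: collinear_sym => //.
  by apply: pu; exact: collinear_sym.
rewrite wv in pw; apply: nzp; apply: collinear_sym.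
apply: (collinear_line hpolar lm vu mv mu mz pw).
exact/pu/collinear_refl.
Qed.

(** Each line on [a] meets H in a point collinear with [c]; if [c] is also collinear with [a], it
    sees the whole line. *)
Lemma perp2_collinear a b c : opposite a b -> perp2 [set a; b] c ->
  collinear c a -> c = a.
Proof.
move=> ab Lc ca; apply/esym/collinear_sub_inj => x xa.
have [->|nxa] := pselect (x = a); first exact: collinear_sym.
have [l [h [ll la lx [lh ha Hh]]]] := project hpolar ab xa nxa.
by apply/collinear_sym/(collinear_line hpolar ll ha lh la lx) => //; exact: Lc.
Qed.

(** If [x] differed from the point [h] of [ax] in H, then [c] would see both, hence [a]. *)
Lemma perp_pair_perp2 a b c : opposite a b -> perp2 [set a; b] c -> c <> a ->
  perp [set a; c] = perp [set a; b].
Proof.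
move=> ab Lc ca; have nca : ~ collinear c a by move/(perp2_collinear ab Lc).
apply/seteqP; split=> x => [/perp_pairP[xa xc]|Hx]; last first.
  apply/perp_pairP; split; first by have /perp_pairP[] := Hx.
  exact/collinear_sym/Lc.
have nxa : x <> a by move=> xE; apply: nca; rewrite -xE; exact: collinear_sym.
have [l [h [ll la lx [lh ha Hh]]]] := project hpolar ab xa nxa.
have [<-//|hx] := pselect (h = x).
case: nca; apply: (collinear_line hpolar ll hx lh lx la); first exact: Lc.
exact: collinear_sym.
Qed.

Lemma perp2_opposite a b c d : opposite a b ->
  perp2 [set a; b] c -> perp2 [set a; b] d -> c <> d ->
  opposite c d /\ perp [set c; d] = perp [set a; b].
Proof.
move=> ab Lc Ld cd.
have [ca|ca] := pselect (c = a).
  rewrite ca in cd *; split; last by apply: perp_pair_perp2 => //; exact: nesym.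
  by move/collinear_sym/(perp2_collinear ab Ld)/esym.
(* The pair [c], [a] has the same perp and double perp as [a], [b], so it can serve as the base
   pair. *)
have E : perp [set c; a] = perp [set a; b] by rewrite setUC; exact: perp_pair_perp2.
have oca : opposite c a by move/(perp2_collinear ab Lc).
have Ld' : perp2 [set c; a] d by rewrite /perp2 E.
split; first by move/collinear_sym/(perp2_collinear oca Ld')/esym.
by rewrite -E; apply: perp_pair_perp2 => //; exact: nesym.
Qed.

Lemma perp2_project a b c x A : opposite a b -> perp2 [set a; b] c ->
  A `<=` perp [set a; b] -> perp A x -> collinear x c -> x <> c ->
  exists l h, [/\ line l, l c, l x &
    [/\ l h, h <> c, perp [set a; b] h & perp A h]].
Proof.
move=> ab Lc AH Ax xc nxc.
have [d Ld cd] : exists2 d, perp2 [set a; b] d & c <> d.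
  have [ca|ca] := pselect (c = a); last by exists a => //; apply: sub_perp2; left.
  exists b; first by apply: sub_perp2; right.
  by move=> cb; apply: ab; rewrite -ca -cb; exact: collinear_refl.
have [ocd E] := perp2_opposite ab Lc Ld cd.
have [l [h [ll lc lx [lh hc Hh]]]] := project hpolar ocd xc nxc.
exists l, h; split=> //; split=> //; first by rewrite -E.
have Ac : perp A c by move=> y /AH; exact: Lc.
exact: (perp_subspace hpolar ll nxc lx lc Ax Ac lh).
Qed.

(** * The two implications between (R2) and (R3) *)

Lemma R2_R3 a b : opposite a b -> R2 a b -> R3 a b.
Proof.
move=> ab r2 X Y gX gY; have [[sX cX] XH _] := gX; have [[sY cY] YH _] := gY.
have near N z : generator_in (perp [set a; b]) N -> perp N z ->
    exists2 c, perp2 [set a; b] c & collinear z c.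
  move=> gN Nz; have [[_ cN] _ _] := gN.
  have [M gM sub] := generator_extend hpolar (clique_setU1 cN Nz).
  have [|c [Mc Lc]] := r2 M gM; first by exists N; split=> // y Ny; apply: sub; right.
  by exists c => //; case: gM => [[_ cM] _]; apply: cM => //; apply: sub; left.
apply/seteqP; split=> [z XYz|]; last first.
  apply: span_sub; first exact: perp_subspace.
  move=> z [[Xz Yz] w [Xw|Yw]|Lz w XYw]; [exact: cX|exact: cY|].
  by apply: Lz; case: XYw => [/XH|/YH].
have Xz : perp X z by apply: perp_anti XYz => ?; left.
have Yz : perp Y z by apply: perp_anti XYz => ?; right.
have [Hz|nHz] := pselect (perp [set a; b] z).
  by apply: sub_span; left; split; apply: generator_in_perp; eassumption.
have [c Lc zc] := near X z gX Xz.
have [->|nzc] := pselect (z = c); first by apply: sub_span; right.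
have XYH : X `|` Y `<=` perp [set a; b] by move=> w [/XH|/YH].
have [l [h [ll lc lz [lh hc Hh XYh]]]] := perp2_project ab Lc XYH XYz zc nzc.
apply: (span_subspace ll hc lh lc) lz; apply: sub_span; [left|by right].
split; apply: generator_in_perp; try eassumption; apply: perp_anti XYh => ?.
- by left.
- by right.
Qed.

Lemma R3_R2 a b : opposite a b -> R3 a b -> R2 a b.
Proof.
move=> ab r3 M gM [N [gN NM]]; have [[sN cN] NH _] := gN.
have [[sM cM] _] := gM.
have memN := generator_in_perp hpolar gN.
pose U := [set x | perp N x /\ exists2 c, perp2 [set a; b] c & collinear x c].
have La : perp2 [set a; b] a by apply: sub_perp2; left.
have LN c : perp2 [set a; b] c -> perp N c by move=> Lc y /NH; exact: Lc.
have cone c x : perp2 [set a; b] c -> perp N x -> collinear x c -> x <> c ->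
    exists l h, [/\ line l, l c, l x & [/\ l h, h <> c & N h]].
  move=> Lc Nx xc nxc.
  have [l [h [ll lc lx [lh hc Hh Nh]]]] := perp2_project ab Lc NH Nx xc nxc.
  by exists l, h; split=> //; split=> //; exact: memN.
have sU : subspace U.
  move=> l x y ll xy lx ly [Nx [c Lc xc]] [Ny [d Ld yd]] z lz.
  split; first exact: (perp_subspace hpolar ll xy lx ly Nx Ny lz).
  have zC e : collinear x e -> collinear y e -> collinear z e.
    move=> xe ye; apply: collinear_sym.
    by apply: (collinear_line hpolar ll xy lx ly lz); apply: collinear_sym.
  (* If [d] does not see [x], the point [h] of [N] on the line [yd] must be [y], since [x] sees [h];
     then [y] is in [N], and [c] sees the whole line [xy]. *)
  have [xd|nxd] := pselect (collinear x d); first by exists d; auto.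
  have xyC : collinear x y by exact: line_collinear lx ly.
  have nyd : y <> d by move=> yE; apply: nxd; rewrite -yE.
  have [m [h [lm md my [mh hd Nh]]]] := cone d y Ld Ny yd nyd.
  have [hy|hy] := pselect (h = y).
    by exists c => //; apply: zC => //; rewrite -hy; exact/collinear_sym/LN.
  by case: nxd; apply: (collinear_line hpolar lm hy mh my md); first exact: Nx.
have NU : perp N `<=` U.
  have := r3 N N gN gN; rewrite setUid setIid => ->.
  apply: span_sub => // x [Nx|Lx].
    split=> [y Ny|]; first exact: cN.
    by exists a => //; have /perp_pairP[] := NH x Nx.
  by split; [exact: LN|exists x => //; exact: collinear_refl].
have [m Mm nNm] : exists2 m, M m & ~ N m.
  (* If [M] were inside [N], then [a], collinear with all of [N], would lie in [M], hence in H, and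
     so be collinear with [b]. *)
  apply: contrapT => noM.
  have MN : M `<=` N by move=> x Mx; apply: contrapT => nNx; apply: noM; exists x.
  have Ma : M a.
    by apply: (generator_perp hpolar gM) => x /MN; exact: (LN a La).
  by have /perp_pairP[_ ab'] := NH a (MN a Ma).
have Nm : perp N m by move=> y /NM; exact: cM.
have [_ [c Lc mc]] := NU m Nm.
have [mcE|nmc] := pselect (m = c); first by exists m; split=> //; rewrite mcE.
have [l [h [ll lc lm [lh _ Nh]]]] := cone c m Lc Nm mc nmc.
have hm : h <> m by move=> hE; apply: nNm; rewrite -hE.
exists c; split=> //.
exact: (sM l h m ll hm lh lm (NM h Nh) Mm c lc).
Qed.

End HyperbolicLine.

Theorem theorem1p1 (S : geometry) (hpolar : polar_space S)
    (hnondeg : nondegenerate S) (hthick : thick_lined S) (hrank : rank_ge S 2)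
    (a b : S) (hab : opposite a b) :
  R2 a b <-> R3 a b.
Proof. by split; [exact: R2_R3|exact: R3_R2]. Qed.
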